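(* For every $\varepsilon > 0$ there exist a constant $c > 0$ and an integer $k_0$ such that the following holds. Let $k \ge k_0$ be an integer and let $G$ be an $n$-vertex finite graph with minimum degree at least $k$. If $p \in [0,1]$ satisfies $p \ge \frac{1+\varepsilon}{k}$, then $\mathbb{E}[\mathrm{exc}(G_p)] \ge cn$.
   Context: For a graph $G$, $e(G)$ is its number of edges, and the number of excess edges is $\mathrm{exc}(G) = e(G) - |V(G)| + (\text{number of connected components of } G)$. For a graph $G$ and $p \in [0,1]$, $G_p$ is the random spanning subgraph of $G$ obtained by keeping each edge of $G$ independently with probability $p$. *)

(* Defs.v *)
From HB Require Import structures.
From mathcomp Require Import all_boot all_order all_algebra.
Set Implicit Arguments.
Unset Strict Implicit.
Unset Printing Implicit Defensive.
Import Order.TTheory GRing.Theory Num.Theory.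
Local Open Scope ring_scope.

Record sgraph (V : finType) := SGraph {
  adj : rel V;
  adj_sym : symmetric adj;
  adj_irrefl : irreflexive adj
}.

(* Edges are unordered pairs, i.e. two-element sets of vertices. *)
Definition edges (V : finType) (G : sgraph V) : {set {set V}} :=
  [set f : {set V} | [exists x, exists y, adj G x y && (f == [set x; y])]].

Definition degree (V : finType) (G : sgraph V) (x : V) : nat :=
  #|[set y | adj G x y]|.

Definition components (V : finType) (G : sgraph V) : nat := n_comp (adj G) V.

Definition exc (V : finType) (G : sgraph V) : int :=
  #|edges G|%:Z - #|V|%:Z + (components G)%:Z.

Section Spanning.
Variables (V : finType) (G : sgraph V) (F : {set {set V}}).

Definition span_adj : rel V := fun x y => adj G x y && ([set x; y] \in F).

Lemma span_adj_sym : symmetric span_adj.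
Proof. by move=> x y; rewrite /span_adj adj_sym setUC. Qed.

Lemma span_adj_irrefl : irreflexive span_adj.
Proof. by move=> x; rewrite /span_adj adj_irrefl. Qed.

Definition spanning_subgraph : sgraph V := SGraph span_adj_sym span_adj_irrefl.

Lemma edges_spanning_subgraph : F \subset edges G -> edges spanning_subgraph = F.
Proof.
move=> /subsetP FG; apply/setP => f; rewrite inE; apply/idP/idP.
  by case/existsP=> x /existsP[y /andP[/andP[_ xyF] /eqP ->]].
move=> fF; move: (FG _ fF); rewrite inE => /existsP[x /existsP[y /andP[xy /eqP fE]]].
by apply/existsP; exists x; apply/existsP; exists y; rewrite /= /span_adj xy -fE fF eqxx.
Qed.

End Spanning.

(* Probability that the edge set of G_p is F, for F \subset edges G. *)
Definition Gp_prob (R : numDomainType) (V : finType) (G : sgraph V) (p : R)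
    (F : {set {set V}}) : R :=
  \prod_(f in edges G) (if f \in F then p else 1 - p).

(* Expectation of X(G_p). *)
Definition Gp_expect (R : numDomainType) (V : finType) (G : sgraph V) (p : R)
    (X : sgraph V -> R) : R :=
  \sum_(F in powerset (edges G)) Gp_prob G p F * X (spanning_subgraph G F).

(* Main.v *)
Require Import Defs.
From mathcomp Require Import all_boot all_order all_algebra.
From mathcomp Require Import reals.
From mathcomp Require Import zify ring lra.
Import Order.TTheory GRing.Theory Num.Theory.
Local Open Scope ring_scope.
Set Implicit Arguments.
Unset Strict Implicit.
Unset Printing Implicit Defensive.

(** Sprinkling. Write G_p as the union of independent G_{p1} and G_{p2} with
    p1 = (1 + eps/2)/k, so that p2 >= eps/(2k). Let A be the set of vertices in
    components of G_{p1} with at least L vertices. While fewer than L vertices have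
    been found, every vertex has at least k - L undiscovered neighbours, so
    exploring the component of a vertex dominates a supercritical branching
    process stopped at size L: the vertex is in A with probability at least
    d = eps/(4 + eps), independently of L. By Harris' inequality an edge of G lies
    inside A with probability at least d^2. Since A meets at most |V|/L components
    of G_{p1}, all but |V|/L of the edges of G_{p2} sprinkled inside A become
    excess edges. As G has at least k|V|/2 edges, this gives an expected excess
    of at least eps d^2 |V|/8 - |V|/L, and we take L > 16/(eps d^2). *)

(** * Expectation over a random subset with independent elements *)

Section RandomSubset.
Variables (R : realFieldType) (T : finType).
Implicit Types (p : R) (S F B : {set T}) (X Y : {set T} -> R) (e : T).

(** Same form as [Gp_prob], but over an arbitrary ground set [S], so that proofs can proceed by
    induction on [S]. *)
Definition subset_prob p S F : R := \prod_(f in S) (if f \in F then p else 1 - p).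

Definition subset_expect p S X : R :=
  \sum_(F in powerset S) subset_prob p S F * X F.

Lemma subset_expect0 p X : subset_expect p set0 X = X set0.
Proof.
by rewrite /subset_expect powerset0 big_set1 /subset_prob big_set0 mul1r.
Qed.

(** Conditioning on whether [e] is kept; this recursion drives the inductions on [S] below. *)
Lemma subset_expectU1 p S e X : e \notin S ->
  subset_expect p (e |: S) X =
    p * subset_expect p S (fun F => X (e |: F)) + (1 - p) * subset_expect p S X.
Proof.
move=> eS; rewrite /subset_expect (bigID (fun F => e \in F)) /=; congr (_ + _).
  rewrite (reindex_onto (fun F => e |: F) (fun F => F :\ e)) /=; last first.
    by move=> F /andP[_ eF]; rewrite setD1K.
  rewrite mulr_sumr; apply: eq_big => F.
    rewrite !inE eqxx /= andbT; apply/andP/idP.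
      move=> [/subsetP sF /eqP FE]; apply/subsetP => f fF.
      have : f \in e |: S by apply: sF; rewrite !inE fF orbT.
      rewrite !inE => /orP[/eqP fe|//]; move: fF; rewrite -FE fe.
      by rewrite !inE eqxx.
    move=> sF; have eF : e \notin F by apply: contra eS; apply: (subsetP sF).
    by rewrite setUS // setU1K.
  move=> /andP[_ /eqP FE].
  have eF : e \notin F by rewrite -FE !inE eqxx.
  rewrite mulrA; congr (_ * _).
  rewrite /subset_prob big_setU1 //= !inE eqxx /=; congr (_ * _).
  by apply: eq_bigr => f fS; rewrite !inE; case: eqP eS => // <-; rewrite fS.
rewrite mulr_sumr; apply: eq_big => F.
  rewrite !inE; apply/andP/idP.
    move=> [/subsetP sF eF]; apply/subsetP => f fF; have := sF _ fF.
    by rewrite !inE => /orP[/eqP fe|//]; rewrite -fe fF in eF.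
  move=> sF; split; first by apply: subset_trans sF _; apply: subsetUr.
  by apply: contra eS; apply: (subsetP sF).
move=> /andP[_ eF].
by rewrite mulrA /subset_prob big_setU1 //= (negPf eF).
Qed.

Lemma set_U1_ind (P : {set T} -> Prop) :
  P set0 -> (forall e S, e \notin S -> P S -> P (e |: S)) -> forall S, P S.
Proof.
move=> P0 PU S; move: {2}#|S| (erefl #|S|) => n; elim: n S => [|n IH] S cS.
  by move/eqP: cS; rewrite cards_eq0 => /eqP->.
have /set0Pn[e eS] : S != set0 by rewrite -card_gt0 cS.
rewrite -(setD1K eS); apply: PU; first by rewrite !inE eqxx.
by apply: IH; move: cS; rewrite (cardsD1 e) eS => -[].
Qed.

Lemma eq_subset_expect p S X Y :
  (forall F, F \subset S -> X F = Y F) -> subset_expect p S X = subset_expect p S Y.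
Proof. by move=> XY; apply: eq_bigr => F; rewrite inE => /XY->. Qed.

Lemma ler_subset_expect p S X Y : 0 <= p <= 1 ->
  (forall F, F \subset S -> X F <= Y F) -> subset_expect p S X <= subset_expect p S Y.
Proof.
move=> /andP[p0 p1] XY; apply: ler_sum => F; rewrite inE => FS.
apply: ler_wpM2l (XY _ FS); apply: prodr_ge0 => f _.
by case: ifP => _ //; rewrite subr_ge0.
Qed.

Lemma subset_expect_cst p S (a : R) : subset_expect p S (fun=> a) = a.
Proof.
elim/set_U1_ind: S => [|e S eS IH]; first by rewrite subset_expect0.
by rewrite subset_expectU1 // IH; ring.
Qed.

Lemma subset_expectD p S X Y :
  subset_expect p S (fun F => X F + Y F) = subset_expect p S X + subset_expect p S Y.
Proof. by rewrite -big_split; apply: eq_bigr => F _; rewrite mulrDr. Qed.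

Lemma subset_expectZ p S (a : R) X :
  subset_expect p S (fun F => a * X F) = a * subset_expect p S X.
Proof. by rewrite mulr_sumr; apply: eq_bigr => F _; rewrite mulrCA. Qed.

Lemma subset_expectB p S X Y :
  subset_expect p S (fun F => X F - Y F) = subset_expect p S X - subset_expect p S Y.
Proof. by rewrite -sumrB; apply: eq_bigr => F _; rewrite mulrBr. Qed.

Lemma subset_expect_sum p S (I : finType) (P : pred I) (X : I -> {set T} -> R) :
  subset_expect p S (fun F => \sum_(i | P i) X i F) =
    \sum_(i | P i) subset_expect p S (X i).
Proof. by rewrite exchange_big; apply: eq_bigr => F _; rewrite mulr_sumr. Qed.

Lemma subset_expect_card p S B : B \subset S ->
  subset_expect p S (fun F => #|F :&: B|%:R) = p * #|B|%:R.
Proof.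
move=> BS; rewrite -{2}(setIidPr BS) {BS}; elim/set_U1_ind: S => [|e S eS IH].
  by rewrite subset_expect0 set0I cards0 mulr0.
rewrite subset_expectU1 // IH.
have cE F : F \subset S -> #|(e |: F) :&: B| = ((e \in B) + #|F :&: B|)%N.
  move=> FS; rewrite setIUl; have [eB|eB] := boolP (e \in B).
    rewrite (setIidPl _) ?sub1set // cardsU1 inE.
    by rewrite (negPf (contra (subsetP FS e) eS)).
  by rewrite disjoint_setI0 ?disjoints1 // set0U.
rewrite cE // (@eq_subset_expect _ _ _ (fun F => (e \in B)%:R + #|F :&: B|%:R)).
  by rewrite subset_expectD subset_expect_cst IH natrD; ring.
by move=> F FS; rewrite cE // natrD.
Qed.

(** An element lies in the union of two independent random sets with probability
    [p1 + p2 - p1 * p2]. In the induction, [e] is exposed in both sets; once the first contains it,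
    its status in the second is irrelevant. *)
Lemma subset_expect_sprinkle p1 p2 S X :
  subset_expect (p1 + p2 - p1 * p2) S X =
    subset_expect p1 S (fun F1 => subset_expect p2 S (fun F2 => X (F1 :|: F2))).
Proof.
elim/set_U1_ind: S X => [|e S eS IH] X; first by rewrite !subset_expect0 setU0.
rewrite !subset_expectU1 // !IH.
pose X1 F1 := subset_expect p2 S (fun F2 => X (e |: (F1 :|: F2))).
pose X0 F1 := subset_expect p2 S (fun F2 => X (F1 :|: F2)).
have E1 F : subset_expect p2 (e |: S) (fun F2 => X ((e |: F) :|: F2)) = X1 F.
  rewrite subset_expectU1 //; transitivity (p2 * X1 F + (1 - p2) * X1 F); last by ring.
  congr (_ * _ + _ * _); apply: eq_subset_expect => F2 _; last by rewrite setUA.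
  by rewrite setUACA setUid.
have E0 F : subset_expect p2 (e |: S) (fun F2 => X (F :|: F2)) =
    p2 * X1 F + (1 - p2) * X0 F.
  rewrite subset_expectU1 //; congr (_ * _ + _).
  by apply: eq_subset_expect => F2 _; rewrite setUCA.
rewrite (eq_subset_expect p1 (fun F _ => E1 F)) (eq_subset_expect p1 (fun F _ => E0 F)).
by rewrite subset_expectD !subset_expectZ; ring.
Qed.

(* Harris' inequality; in the induction step the two conditional expectations
   are ordered the same way for X and Y, which is Chebyshev's sum inequality. *)
Lemma subset_expect_harris p S X Y : 0 <= p <= 1 ->
  (forall F1 F2, F1 \subset F2 -> X F1 <= X F2) ->
  (forall F1 F2, F1 \subset F2 -> Y F1 <= Y F2) ->
  subset_expect p S X * subset_expect p S Y <= subset_expect p S (fun F => X F * Y F).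
Proof.
move=> p01; elim/set_U1_ind: S X Y => [|e S eS IH] X Y mX mY.
  by rewrite !subset_expect0.
rewrite !subset_expectU1 //.
have mU (Z : {set T} -> R) : (forall F1 F2, F1 \subset F2 -> Z F1 <= Z F2) ->
    forall F1 F2 : {set T}, F1 \subset F2 -> Z (e |: F1) <= Z (e |: F2).
  by move=> mZ F1 F2 F12; apply: mZ; apply: setUS.
have h0 := IH _ _ mX mY; have h1 := IH _ _ (mU X mX) (mU Y mY).
have hX : subset_expect p S X <= subset_expect p S (fun F => X (e |: F)).
  by apply: ler_subset_expect => // F _; apply/mX/subsetUr.
have hY : subset_expect p S Y <= subset_expect p S (fun F => Y (e |: F)).
  by apply: ler_subset_expect => // F _; apply/mY/subsetUr.
case/andP: p01 => p0 p1.
move: h0 h1 hX hY; set a := subset_expect _ _ _; set b := subset_expect _ _ _.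
set c := subset_expect _ _ _; set a' := subset_expect _ _ _.
set b' := subset_expect _ _ _; set c' := subset_expect _ _ _.
move=> h0 h1 hX hY.
have k0 : (1 - p) * (a * b) <= (1 - p) * c by apply: ler_wpM2l => //; rewrite subr_ge0.
have k1 : p * (a' * b') <= p * c' by apply: ler_wpM2l.
have k2 : 0 <= p * (1 - p) * ((a' - a) * (b' - b)) by rewrite !mulr_ge0 ?subr_ge0.
nra.
Qed.

End RandomSubset.

(** * Components and excess when edges are added *)

Section Excess.
Variables (V : finType) (G : sgraph V).
Implicit Types (F D : {set {set V}}) (A C : {set V}) (x y : V).

Local Notation conn F := (connect (span_adj G F)).
Local Notation sub F := (spanning_subgraph G F).
Local Notation comp_root F := (fingraph.root (span_adj G F)).

Lemma conn_sym F : connect_sym (span_adj G F).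
Proof. exact/sym_connect_sym/span_adj_sym. Qed.

Lemma conn_mono F F' x y : F \subset F' -> conn F x y -> conn F' x y.
Proof.
move=> FF'; apply: connect_sub => u v /andP[uv uvF]; apply: connect1.
by rewrite /span_adj uv (subsetP FF').
Qed.

Lemma edgesP f : reflect (exists x y, adj G x y /\ f = [set x; y]) (f \in edges G).
Proof.
rewrite inE; apply: (iffP existsP) => [[x /existsP[y /andP[xy /eqP->]]]|].
  by exists x, y.
by move=> [x [y [xy ->]]]; exists x; apply/existsP; exists y; rewrite xy eqxx.
Qed.

Definition reach F C : {set V} := [set w | [exists a in C, conn F a w]].

Lemma reachP F C w : reflect (exists2 a, a \in C & conn F a w) (w \in reach F C).
Proof. by rewrite inE; apply: exists_inP. Qed.

Lemma reach1E F x w : (w \in reach F [set x]) = conn F x w.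
Proof. by apply/reachP/idP => [[a /set1P->]|xw] //; exists x; rewrite ?set11. Qed.

Definition large_part L F : {set V} := [set v | (L <= #|reach F [set v]|)%N].

(** A path leaving a vertex outside [A] never meets an edge of [F'] missing from [F], since such
    edges have their ends in [A]; closedness of [A] keeps it outside at each step. *)
Lemma conn_outside F F' A x y : closed (span_adj G F) A ->
  (forall u v, adj G u v -> [set u; v] \in F' :\: F -> u \in A) ->
  x \notin A -> conn F' x y -> conn F x y && (y \notin A).
Proof.
move=> cA sA xA /connectP[s]; elim: s x xA => [|z s IH] x xA /=.
  by move=> _ ->; rewrite connect0.
move=> /andP[/andP[xz xzF'] zs] yE.
have xzF : span_adj G F x z.
  rewrite /span_adj xz; apply: contraNT xA => xzF.
  by apply: sA xz _; rewrite !inE xzF.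
have zA : z \notin A by rewrite -(cA _ _ xzF).
have /andP[zy ->] := IH _ zA zs yE.
by rewrite (connect_trans (connect1 xzF) zy).
Qed.

(** Components of [F] outside [A] stay distinct under [F'], and a nonempty [A] contributes at least
    one component different from all of these. *)
Lemma components_ge F F' A : closed (span_adj G F) A ->
  (forall u v, adj G u v -> [set u; v] \in F' :\: F -> u \in A) ->
  (#|[set x in roots (span_adj G F) | x \notin A]| + (A != set0) <= components (sub F'))%N.
Proof.
move=> cA sA; set X := [set x in _ | _].
have inj : {in X &, injective (fun z => comp_root F' z)}.
  move=> x y; rewrite !inE => /andP[/eqP rx xA] /andP[/eqP ry yA].
  move/(fingraph.rootP (conn_sym F')) => /(conn_outside cA sA xA)/andP[xy _].
  by rewrite -rx -ry; apply/(fingraph.rootP (conn_sym F)).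
rewrite -(card_in_imset inj) /components /n_comp_mem.
have sX : [set comp_root F' z | z in X] \subset predI (roots (span_adj G F')) V.
  apply/subsetP => _ /imsetP[x _ ->].
  by rewrite !inE andbT; apply: roots_root (conn_sym F') _.
have [_|/set0Pn[a aA]] := eqVneq A set0; first by rewrite addn0 subset_leq_card.
suff aX : comp_root F' a \notin [set comp_root F' z | z in X].
  rewrite (_ : _ + _ = #|comp_root F' a |: [set comp_root F' z | z in X]|)%N; last first.
    by rewrite cardsU1 aX addnC.
  apply/subset_leq_card/subsetP => z.
  rewrite inE => /orP[/set1P->|/(subsetP sX)//].
  by rewrite !inE andbT; apply: roots_root (conn_sym F') _.
apply/imsetP => -[x]; rewrite inE => /andP[_ xA] /esym.
move/(fingraph.rootP (conn_sym F')) => /(conn_outside cA sA xA)/andP[_].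
by rewrite aA.
Qed.

Lemma components_split F A :
  components (sub F) = (#|[set x in roots (span_adj G F) | x \in A]|
    + #|[set x in roots (span_adj G F) | x \notin A]|)%N.
Proof.
rewrite /components (n_compC (mem A)).
by congr (_ + _)%N; apply: eq_card => x; rewrite !inE.
Qed.

Lemma closed_reach F C : closed (span_adj G F) (reach F C).
Proof.
apply: (intro_closed (conn_sym F)) => x y xy /reachP[a aC ax].
by apply/reachP; exists a => //; apply: connect_trans ax (connect1 xy).
Qed.

Lemma exc_sub F : F \subset edges G ->
  exc (sub F) = #|F|%:Z - #|V|%:Z + (components (sub F))%:Z.
Proof. by move=> FG; rewrite /exc edges_spanning_subgraph. Qed.

Lemma exc_set0 : exc (sub set0) = 0.
Proof.
rewrite exc_sub ?sub0set // cards0 sub0r.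
suff -> : components (sub set0) = #|V| by rewrite addNr.
apply: eq_card => x; rewrite !inE andbT; apply/eqP.
have /connectP[[|y s] /= xs ->] := connect_root (span_adj G set0) x => //.
by move: xs; rewrite /span_adj inE andbF.
Qed.

(** A new edge adds one to the edge count and merges at most two components into one, namely those
    of its ends, whose union is [A]. *)
Lemma exc_setU1 F f : F \subset edges G -> f \in edges G ->
  exc (sub F) <= exc (sub (f |: F)).
Proof.
move=> FG fG; have [fF|fF] := boolP (f \in F).
  by rewrite (setUidPr _) // sub1set.
have /edgesP[x [y [xy fE]]] := fG.
rewrite !exc_sub // ?subUset ?sub1set ?fG // cardsU1 fF.
set A := reach F [set x; y].
have xA : x \in A by apply/reachP; exists x; rewrite ?set21.
have yA : y \in A by apply/reachP; exists y; rewrite ?set22.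
have A0 : A != set0 by apply/set0Pn; exists x.
have := @components_ge F (f |: F) A (@closed_reach _ _); rewrite A0 => /(_ _) H.
have {}H : (#|[set z in roots (span_adj G F) | z \notin A]| + true <=
   components (sub (f |: F)))%N.
  apply: H => u v uv; rewrite in_setD in_setU1 => /andP[uvF].
  rewrite (negPf uvF) orbF fE => /eqP uvE.
  have : u \in [set x; y] by rewrite -uvE set21.
  by case/set2P => ->.
have H2 : (#|[set z in roots (span_adj G F) | z \in A]| <= 2)%N.
  apply: leq_trans (_ : #|[set comp_root F x; comp_root F y]| <= _)%N.
    apply/subset_leq_card/subsetP => z; rewrite inE => /andP[/eqP rz /reachP[a]].
    by move=> /set2P[]-> /(fingraph.rootP (conn_sym F)); rewrite rz => <-;
      rewrite ?set21 ?set22.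
  by rewrite cards2; case: eqP.
rewrite (components_split F A); lia.
Qed.

Lemma exc_setU F D : F \subset edges G -> D \subset edges G ->
  exc (sub F) <= exc (sub (D :|: F)).
Proof.
move=> FG; elim/set_U1_ind: D => [|f D _ IH]; first by rewrite set0U.
rewrite subUset sub1set -setUA => /andP[fG DG].
by apply: le_trans (IH DG) (exc_setU1 _ fG); rewrite subUset DG.
Qed.

(** Distinct roots in the large part have disjoint components, each with at least [L] vertices. *)
Lemma card_large_roots L F :
  (L * #|[set x in roots (span_adj G F) | x \in large_part L F]| <= #|V|)%N.
Proof.
set X := [set x in _ | _].
rewrite mulnC -sum_nat_const.
apply: (@leq_trans (\sum_(x in X) #|reach F [set x]|)%N).
  by apply: leq_sum => x; rewrite !inE => /andP[].
apply: (@leq_trans (\sum_(v | comp_root F v \in X) 1)%N); last first.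
  by rewrite sum1_card; apply: max_card.
rewrite [leqRHS](partition_big (fun v => comp_root F v) [in X]) //=.
apply: leq_sum => x xX; rewrite sum1_card; apply/subset_leq_card/subsetP => v.
rewrite reach1E unfold_in => /(fingraph.rootP (conn_sym F)) <-.
by move: (xX); rewrite inE => /andP[/eqP -> _]; rewrite xX eqxx.
Qed.

(* Keeping only the sprinkled edges inside the large part does not increase the
   excess, and these edges only merge components meeting the large part, of which
   there are at most |V| / L. *)
Lemma exc_sprinkle L F1 F2 : F1 \subset edges G -> F2 \subset edges G ->
  (L * #|F2 :&: [set f in edges G | (f \subset large_part L F1) && (f \notin F1)]|)%:Z
    - #|V|%:Z <= L%:Z * exc (sub (F1 :|: F2)).
Proof.
move=> F1G F2G; set A := large_part L F1; set D := _ :&: _.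
have DG : D \subset edges G by apply: subset_trans F2G; apply: subsetIl.
have DF1 : [disjoint D & F1].
  by apply/pred0P => f; rewrite !inE; case: (f \in F1); rewrite ?andbF.
have exc2 : exc (sub (D :|: F1)) <= exc (sub (F1 :|: F2)).
  have -> : F1 :|: F2 = F2 :|: (D :|: F1).
    by rewrite setUA (setUidPl (subsetIl _ _)) setUC.
  by apply: exc_setU; rewrite ?subUset ?DG.
have exc1 : 0 <= exc (sub F1).
  by rewrite -exc_set0 -[F1]setU0; apply: exc_setU; rewrite ?sub0set.
have cA : closed (span_adj G F1) A.
  move=> x y xy.
  have reachE : reach F1 [set x] = reach F1 [set y].
    apply/setP => w; rewrite !reach1E.
    exact: same_connect (conn_sym F1) _ _ (connect1 xy) w.
  by rewrite inE reachE [RHS]inE.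
have := @components_ge F1 (D :|: F1) A cA; move=> /(_ _) H.
have {H} : (#|[set z in roots (span_adj G F1) | z \notin A]| <=
   components (sub (D :|: F1)))%N.
  apply: leq_trans (H _); first by rewrite leq_addr.
  move=> u v uv; rewrite in_setD in_setU => /andP[uvF].
  rewrite (negPf uvF) orbF => /setIP[_]; rewrite inE => /and3P[_ /subsetP sA _].
  by apply: sA; rewrite set21.
have := card_large_roots L F1; rewrite -/A.
move: exc1 exc2.
rewrite [exc (sub F1)]exc_sub // [exc (sub (D :|: F1))]exc_sub ?subUset ?DG //.
rewrite (components_split F1 A) cardsU (disjoint_setI0 DF1) cards0 subn0.
move: (exc _) (components _) => E c exc1 exc2 La ge_c.
set a := #|[set z in _ | z \in A]| in exc1 La.
(* Relative to [F1], adding [D] gains [#|D|] edges and loses at most the [a] components inside [A];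
   the excess of [F1] itself is nonnegative. *)
have : #|D|%:Z - a%:Z <= E by lia.
move/(ler_wpM2l (ler0n int L)); rewrite natz; lia.
Qed.

End Excess.

(** * Exploring components, and the expected excess after sprinkling *)

Section Exploration.
Variables (R : realFieldType) (V : finType) (G : sgraph V).
Implicit Types (F U : {set {set V}}) (C Q N : {set V}) (x y : V).

Lemma ler_bool (a b : bool) : (a -> b) -> a%:R <= b%:R :> R.
Proof. by case: a => [->|_] //; apply: ler0n. Qed.

Lemma reach_mono F F' C C' : F \subset F' -> C \subset C' ->
  reach G F C \subset reach G F' C'.
Proof.
move=> FF' CC'; apply/subsetP => w /reachP[a aC aw].
by apply/reachP; exists a; [apply: (subsetP CC') | apply: conn_mono aw].
Qed.

Lemma reach_id F C : C \subset reach G F C.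
Proof. by apply/subsetP => a aC; apply/reachP; exists a. Qed.

Lemma reach_setU1 F C x y : x \in C -> adj G x y ->
  reach G F (y |: C) \subset reach G ([set x; y] |: F) C.
Proof.
move=> xC xy; apply/subsetP => w /reachP[a /setU1P[->|aC] aw]; apply/reachP.
  exists x => //; apply: (@connect_trans _ _ y).
    by apply: connect1; rewrite /span_adj xy setU11.
  by apply: conn_mono aw; apply: subsetUr.
by exists a => //; apply: conn_mono aw; apply: subsetUr.
Qed.

(* A search revealing one edge at a time: C is the set of vertices
   found so far, Q the queue, x the vertex being processed, N the neighbours of x
   still to be tested and U the set of unrevealed edges. With s the generating
   function of one Bernoulli(p) offspring at q, the potential q^|Q| s^|N| is a
   supermartingale as long as every vertex has at least m neighbours outside C. *)
Lemma exploration (p q : R) (L m : nat) U C Q N x :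
  0 <= p <= 1 -> 0 <= q <= 1 -> (1 - p + p * q) ^+ m <= q ->
  (forall v, (m + L <= degree G v)%N) ->
  x \in C -> Q \subset C :\ x ->
  (forall y, y \in N -> [/\ y \notin C, adj G x y & [set x; y] \in U]) ->
  (forall a b, adj G a b -> b \notin C -> (a \in Q) || (a \notin C) -> [set a; b] \in U) ->
  subset_expect p U (fun F => (#|reach G F C| < L)%:R)
    <= q ^+ #|Q| * (1 - p + p * q) ^+ #|N|.
Proof.
move=> p01 q01; set s := 1 - p + p * q => sm deg.
have /andP[p0 p1] := p01; have /andP[q0 q1] := q01.
have s0 : 0 <= s by rewrite addr_ge0 ?subr_ge0 ?mulr_ge0.
have s1 : s <= 1 by rewrite /s -addrA gerDl addrC subr_le0 ler_piMr.
(* Revealing an edge shrinks [U] by one and may enlarge [Q] by one; taking a vertex off the queue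
   shrinks [Q] alone. The weight 2 makes both moves decrease the measure. *)
have [n] := ubnP (2 * #|U| + #|Q|)%N.
elim: n U C Q N x => // n IH U C Q N x le_n xC QC hN hU.
have [N0|/set0Pn[y yN]] := eqVneq N set0.
  have [->|/set0Pn[z zQ]] := eqVneq Q set0.
    rewrite N0 !cards0 !expr0 mulr1 -[leRHS](subset_expect_cst p U).
    by apply: ler_subset_expect => // F _; rewrite lern1 leq_b1.
  have [LC|CL] := leqP L #|C|.
    rewrite (@eq_subset_expect _ _ _ _ _ (fun=> 0)).
      by rewrite subset_expect_cst mulr_ge0 ?exprn_ge0.
    move=> F _; rewrite ltnNge (leq_trans LC) //.
    by apply/subset_leq_card/reach_id.
  (* The next queued vertex [z] is processed. As [C] has fewer than [L] vertices, [M] has at least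
     [m], so [s ^+ #|M| <= q] makes up for the factor [q] lost with [z]. *)
  pose M := [set y | adj G z y] :\: C.
  have zC : z \in C by have := subsetP QC z zQ; rewrite inE => /andP[].
  have Mm : (m <= #|M|)%N.
    rewrite cardsD; have := deg z; rewrite /degree.
    have := subset_leq_card (subsetIr [set y | adj G z y] C); lia.
  have IHz : subset_expect p U (fun F => (#|reach G F C| < L)%:R)
      <= q ^+ #|Q :\ z| * s ^+ #|M|.
    apply: (IH U C (Q :\ z) M z) => //.
    - by move: le_n; rewrite (cardsD1 z Q) zQ; clear; lia.
    - by apply: setSD; apply: subset_trans QC _; apply: subsetDl.
    - move=> y; rewrite !inE => /andP[yC zy]; split=> //.
      by apply: hU; rewrite ?zQ.
    move=> a b ab bC; rewrite !inE => aQ; apply: hU => //.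
    by case/orP: aQ => [/andP[_ ->]|->]; rewrite ?orbT.
  apply: le_trans IHz _; rewrite N0 cards0 expr0 mulr1 (cardsD1 z Q) zQ exprS mulrC.
  apply: ler_wpM2r; first exact: exprn_ge0.
  by apply: le_trans sm; apply: ler_wiXn2l.
have [yC xy xyU] := hN y yN.
set e := [set x; y] in xyU.
have xQ : x \notin Q by apply/negP => /(subsetP QC); rewrite !inE eqxx.
have eU : e \notin U :\ e by rewrite !inE eqxx.
have neq_yx : y != x by apply: contraNneq yC => ->.
(* The invariant [hU] never asks for [e] again: [x] is in [C], so it cannot be the undiscovered end
   [b], and it is not queued, so it cannot be [a]. *)
have neq_e a b : b \notin C -> (a \in Q) || (a \notin C) -> [set a; b] = e -> False.
  move=> bC aQ abE.
  have : x \in [set a; b] by rewrite abE set21.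
  case/set2P => xE; last by rewrite -xE xC in bC.
  by move: aQ; rewrite -xE xC (negPf xQ).
have cU : #|U| = #|U :\ e|.+1 by rewrite (cardsD1 e) xyU.
have cN : #|N| = #|N :\ y|.+1 by rewrite (cardsD1 y) yN.
have neq_xz z : z \in N :\ y -> [set x; z] != e.
  rewrite !inE => /andP[zy zN]; apply/eqP => zE.
  have : z \in e by rewrite -zE set22.
  have [zC _ _] := hN z zN.
  by case/set2P => zE'; [rewrite zE' xC in zC | rewrite zE' eqxx in zy].
(* If [e] is present, [y] joins both [C] and the queue, which brings an extra factor [q]. In
   [missed] below, [y] stays undiscovered and may still be found from another vertex. *)
have found : subset_expect p (U :\ e) (fun F => (#|reach G (e |: F) C| < L)%:R)
    <= q ^+ #|Q|.+1 * s ^+ #|N :\ y|.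
  apply: (@le_trans _ _ (subset_expect p (U :\ e) (fun F => (#|reach G F (y |: C)| < L)%:R))).
    apply: ler_subset_expect => // F _; apply: ler_bool; apply: leq_ltn_trans.
    exact/subset_leq_card/(reach_setU1 F xC xy).
  have yQ : y \notin Q by apply: contra yC => /(subsetP QC); rewrite inE => /andP[].
  have -> : #|Q|.+1 = #|y |: Q| by rewrite cardsU1 yQ.
  apply: (IH (U :\ e) (y |: C) (y |: Q) (N :\ y) x).
  - by move: le_n; rewrite cU cardsU1 yQ mulnS; clear; lia.
  - by rewrite !inE xC orbT.
  - rewrite subUset sub1set !inE eqxx neq_yx /=.
    by apply: subset_trans QC _; apply: setSD; apply: subsetUr.
  - move=> z zN; have neq := neq_xz z zN; move: zN; rewrite !inE => /andP[zy zN].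
    have [zC xz xzU] := hN z zN.
    by split=> //; [rewrite negb_or zy | rewrite neq].
  move=> a b ab; rewrite in_setU1 negb_or => /andP[by_ bC]; rewrite !in_setU1 => aQ.
  have aQ' : (a \in Q) || (a \notin C).
    case/orP: aQ => [/orP[/eqP->|->] //|]; first by rewrite yC orbT.
    by rewrite negb_or => /andP[_ ->]; rewrite orbT.
  by rewrite in_setD1 hU // andbT; apply/eqP => /(neq_e _ _ bC aQ').
have missed : subset_expect p (U :\ e) (fun F => (#|reach G F C| < L)%:R)
    <= q ^+ #|Q| * s ^+ #|N :\ y|.
  apply: (IH (U :\ e) C Q (N :\ y) x) => //.
  - by move: le_n; rewrite cU mulnS; clear; lia.
  - move=> z zN; have neq := neq_xz z zN; move: zN; rewrite !inE => /andP[zy zN].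
    by have [zC xz xzU] := hN z zN; split=> //; rewrite neq.
  move=> a b ab bC aQ.
  by rewrite in_setD1 hU // andbT; apply/eqP => /(neq_e _ _ bC aQ).
rewrite -{1}(setD1K xyU) subset_expectU1 // cN.
have -> : q ^+ #|Q| * s ^+ #|N :\ y|.+1 =
    p * (q ^+ #|Q|.+1 * s ^+ #|N :\ y|) + (1 - p) * (q ^+ #|Q| * s ^+ #|N :\ y|).
  by rewrite !exprS {1}/s; ring.
by apply: lerD; apply: ler_wpM2l; rewrite ?subr_ge0.
Qed.

(** Exploring from [v] with an empty queue and all edges unrevealed bounds the failure probability
    by [s] to the power [degree G v], where [s = 1 - p + p * q], hence by [q]. *)
Lemma large_part_prob (p q : R) (L m : nat) v :
  0 <= p <= 1 -> 0 <= q <= 1 -> (1 - p + p * q) ^+ m <= q ->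
  (forall v, (m + L <= degree G v)%N) ->
  1 - q <= subset_expect p (edges G) (fun F => (v \in large_part G L F)%:R).
Proof.
move=> p01 q01 sm deg.
have /andP[p0 p1] := p01; have /andP[q0 q1] := q01.
rewrite (@eq_subset_expect _ _ _ _ _
  (fun F => 1 - (#|reach G F [set v]| < L)%:R)); last first.
  by move=> F _; rewrite inE; case: ltnP; rewrite /= ?subrr ?subr0.
rewrite subset_expectB subset_expect_cst lerD2l lerN2.
apply: (@le_trans _ _ (q ^+ #|@set0 V| * (1 - p + p * q) ^+ #|[set y | adj G v y]|)).
  apply: (@exploration _ _ L m _ _ _ _ v) => //; rewrite ?set11 ?sub0set //.
    move=> y; rewrite !inE => vy; split=> //; last first.
      by apply/existsP; exists v; apply/existsP; exists y; rewrite vy eqxx.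
    by apply/eqP => yv; rewrite yv adj_irrefl in vy.
  by move=> a b ab _ _; apply/edgesP; exists a, b.
rewrite cards0 expr0 mul1r; apply: le_trans sm; apply: ler_wiXn2l.
- by rewrite addr_ge0 ?subr_ge0 ?mulr_ge0.
- by rewrite -addrA gerDl addrC subr_le0 ler_piMr.
by apply: leq_trans (deg v); apply: leq_addr.
Qed.

Lemma large_part_mono L F1 F2 : F1 \subset F2 ->
  large_part G L F1 \subset large_part G L F2.
Proof.
move=> F12; apply/subsetP => v; rewrite !inE => Lv.
by apply: leq_trans Lv _; apply/subset_leq_card/reach_mono.
Qed.

Lemma large_part_edge_prob (p q : R) (L m : nat) f :
  0 <= p <= 1 -> 0 <= q <= 1 -> (1 - p + p * q) ^+ m <= q ->
  (forall v, (m + L <= degree G v)%N) -> f \in edges G ->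
  (1 - q) ^+ 2 <= subset_expect p (edges G) (fun F => (f \subset large_part G L F)%:R).
Proof.
move=> p01 q01 sm deg /edgesP[x [y [_ ->]]].
have mono v F1 F2 : F1 \subset F2 ->
    (v \in large_part G L F1)%:R <= (v \in large_part G L F2)%:R :> R.
  by move=> F12; apply: ler_bool; apply/subsetP/large_part_mono.
have := @subset_expect_harris R _ p (edges G) _ _ p01 (mono x) (mono y).
have Px := large_part_prob x p01 q01 sm deg; have Py := large_part_prob y p01 q01 sm deg.
have q1 : 0 <= 1 - q by case/andP: q01; rewrite subr_ge0.
move=> H; rewrite (@eq_subset_expect _ _ _ _ _
  (fun F => (x \in large_part G L F)%:R * (y \in large_part G L F)%:R)).
  by apply: le_trans H; rewrite expr2; apply: ler_pM.
by move=> F _; rewrite subUset !sub1set -natrM mulnb.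
Qed.

(** Double counting of vertex-edge incidences. *)
Lemma card_edges_ge k : (forall v, (k <= degree G v)%N) -> (#|V| * k <= 2 * #|edges G|)%N.
Proof.
move=> deg; rewrite -sum_nat_const.
apply: (@leq_trans (\sum_v \sum_(f in edges G) (v \in f))%N).
  apply: leq_sum => v _; apply: leq_trans (deg v) _.
  rewrite -big_mkcondr sum1_card /degree.
  rewrite -(card_in_imset (f := fun y => [set v; y])).
    apply/subset_leq_card/subsetP => _ /imsetP[y + ->]; rewrite inE => vy.
    by rewrite unfold_in set21 andbT; apply/edgesP; exists v, y.
  move=> y z; rewrite !inE => vy vz yz.
  have : y \in [set v; z] by rewrite -yz set22.
  by case/set2P => // yv; rewrite yv adj_irrefl in vy.
rewrite exchange_big mulnC -sum_nat_const.
apply: leq_sum => f /edgesP[x [y [_ ->]]].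
by rewrite -big_mkcond sum1_card cards2; case: eqP.
Qed.

(** Given [F1], the independent second round keeps on average [p2 * #|B F1|] edges of [B F1]. The
    correction [- p1] discounts edges already present in the first round, which cannot count as
    new. *)
Lemma sprinkle_bound (p1 p2 q : R) (L m k : nat) :
  0 <= p1 <= 1 -> 0 <= p2 <= 1 -> 0 <= q <= 1 -> (1 - p1 + p1 * q) ^+ m <= q ->
  (forall v, (m + L <= degree G v)%N) ->
  L%:R * (p2 * (((1 - q) ^+ 2 - p1) * #|edges G|%:R)) - #|V|%:R
  <= L%:R * Gp_expect G (p1 + p2 - p1 * p2) (fun H => (exc H)%:~R).
Proof.
move=> p1_01 p2_01 q01 sm deg.
rewrite [Gp_expect _ _ _](_ : _ = subset_expect (p1 + p2 - p1 * p2) (edges G)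
  (fun F => (exc (spanning_subgraph G F))%:~R)) // subset_expect_sprinkle.
pose B F1 := [set f in edges G | (f \subset large_part G L F1) && (f \notin F1)].
have step F1 : F1 \subset edges G ->
  L%:R * (p2 * #|B F1|%:R) - #|V|%:R <= L%:R * subset_expect p2 (edges G)
     (fun F2 => (exc (spanning_subgraph G (F1 :|: F2)))%:~R).
  move=> F1G.
  have BG : B F1 \subset edges G by apply/subsetP => f; rewrite inE => /andP[].
  rewrite -(subset_expect_card p2 BG) -!subset_expectZ.
  rewrite -(subset_expect_cst p2 (edges G) #|V|%:R) -subset_expectB.
  apply: ler_subset_expect => // F2 F2G.
  have := exc_sprinkle L F1G F2G; rewrite -(ler_int R).
  by rewrite rmorphB /= intrM -!pmulrn natrM.
rewrite -subset_expectZ.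
apply: (@le_trans _ _ (subset_expect p1 (edges G)
  (fun F1 => L%:R * (p2 * #|B F1|%:R) - #|V|%:R))); last first.
  by apply: ler_subset_expect.
rewrite subset_expectB subset_expect_cst !subset_expectZ lerD2r.
apply: ler_wpM2l => //; apply: ler_wpM2l; first by case/andP: p2_01.
(* [#|B F|] is at least the number of edges inside the large part minus the size of [F];
   expectations of both terms are then available. *)
apply: (@le_trans _ _ (subset_expect p1 (edges G)
   (fun F => \sum_(f in edges G) (f \subset large_part G L F)%:R - #|F :&: edges G|%:R))).
  rewrite subset_expectB subset_expect_card // subset_expect_sum mulrBl lerD2r.
  rewrite mulr_natr -sumr_const; apply: ler_sum => f fG.
  exact: large_part_edge_prob p1_01 q01 sm deg fG.
apply: ler_subset_expect => // F FG; rewrite lerBlDr -natr_sum -natrD ler_nat.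
rewrite -big_mkcondr sum1_card.
apply: leq_trans (leq_card_setU _ _); apply/subset_leq_card/subsetP => f.
rewrite unfold_in => /andP[fG fA]; rewrite !inE in fG *.
by rewrite fG fA andbT; case: (f \in F).
Qed.

End Exploration.

(** * Numerical estimates and choice of constants *)

(** Induction using [(1 - x) * (1 + (m + 1) * x) = 1 + m * x - (m + 1) * x ^+ 2]. *)
Lemma exprB1_mulr_le1 (R : realFieldType) (x : R) m : 0 <= x <= 1 ->
  (1 - x) ^+ m * (1 + m%:R * x) <= 1.
Proof.
move=> /andP[x0 x1]; elim: m => [|m IH]; first by rewrite expr0 mul0r addr0 mulr1.
apply: le_trans IH; rewrite exprSr -mulrA; apply: ler_wpM2l.
  by rewrite exprn_ge0 // subr_ge0.
rewrite -natr1; have : 0 <= (m%:R + 1) * x ^+ 2 by rewrite mulr_ge0 ?sqr_ge0 ?addr_ge0.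
by move: (m%:R) => a; lra.
Qed.

(* Bernoulli's inequality turns the fixed-point condition on q into
   (1 + m p1 (1 - q)) q >= 1, where m p1 >= 1 + eps / 4; q = 4 / (4 + eps)
   solves it. *)
Lemma offspring_gf_le (R : realFieldType) (eps p1 : R) m : 0 < eps -> 0 <= p1 <= 1 ->
  1 + eps / 4 <= m%:R * p1 ->
  (1 - p1 + p1 * (4 / (4 + eps))) ^+ m <= 4 / (4 + eps).
Proof.
move=> e0 /andP[p0 p1_1] mp.
have e4 : 0 < 4 + eps by lra.
set d := eps / (4 + eps).
have qE : 4 / (4 + eps) = 1 - d by rewrite /d; field; rewrite gt_eqF.
have d0 : 0 < d by rewrite divr_gt0.
have d1 : d <= 1 by rewrite ler_pdivrMr //; lra.
have -> : 1 - p1 + p1 * (4 / (4 + eps)) = 1 - p1 * d by rewrite qE; ring.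
have x01 : 0 <= p1 * d <= 1 by rewrite mulr_ge0 ?(ltW d0) //= mulr_ile1 // ltW.
have := exprB1_mulr_le1 m x01.
have m1 : 1 + eps / 4 <= 1 + m%:R * (p1 * d).
  rewrite lerD2l mulrA; apply: le_trans (ler_wpM2r (ltW d0) mp).
  by rewrite (_ : (1 + eps / 4) * d = eps / 4) // /d; field; rewrite gt_eqF.
have pos : 0 < 1 + m%:R * (p1 * d) by apply: lt_le_trans m1; lra.
rewrite -ler_pdivlMr // => /le_trans; apply.
rewrite div1r -[4 / _]invrK lef_pV2 ?posrE ?invr_gt0 ?divr_gt0 //.
by rewrite (_ : (4 / (4 + eps))^-1 = 1 + eps / 4) //; field; rewrite gt_eqF.
Qed.

Theorem theorem5p3 (R : realType) (eps : R) (heps : 0 < eps) :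
  exists (c : R) (k0 : nat), 0 < c /\
    forall (k : nat), (k0 <= k)%N ->
    forall (V : finType) (G : sgraph V),
      (forall x : V, (k <= degree G x)%N) ->
    forall p : R, 0 <= p <= 1 -> (1 + eps) / k%:R <= p ->
      c * #|V|%:R <= Gp_expect G p (fun H => (exc H)%:~R).
Proof.
have e4 : 0 < 4 + eps by lra.
pose q := 4 / (4 + eps); pose d := 1 - q.
have q0 : 0 < q by rewrite divr_gt0.
have q1 : q < 1 by rewrite ltr_pdivrMr //; lra.
have d0 : 0 < d by rewrite subr_gt0.
have dd0 : 0 < d ^+ 2 by rewrite exprn_gt0.
(* The gain per vertex will be [eps * d ^+ 2 / 8]; this [L] makes the loss [1 / L] less than half of
   it, which leaves [c = eps * d ^+ 2 / 16]. *)
pose L := Num.bound (16 / (eps * d ^+ 2)).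
have LE : 16 < L%:R * (eps * d ^+ 2).
  by rewrite -ltr_pdivrMr ?mulr_gt0 //; apply: archi_boundP; rewrite divr_ge0 ?mulr_ge0 // ltW.
(* For [k] above [a1], [(k - L) * p1 >= 1 + eps / 4]; above [a2], [p1 <= d ^+ 2 / 2]. The summand
   [1 + eps] in the threshold gives [p1 < 1]. *)
pose a1 := L%:R * (4 + 2 * eps) / eps.
pose a2 := (2 + eps) / d ^+ 2.
have a1_0 : 0 <= a1 by rewrite divr_ge0 ?mulr_ge0 ?addr_ge0 ?mulr_ge0 // ltW.
have a2_0 : 0 <= a2 by rewrite divr_ge0 ?addr_ge0 // ltW.
exists (eps * d ^+ 2 / 16), (Num.bound (a1 + a2 + (1 + eps))).
split; first by rewrite divr_gt0 ?mulr_gt0.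
move=> k k0k V G deg p /andP[p_ge0 p_le1] hp.
have kbig : a1 + a2 + (1 + eps) < k%:R.
  apply: lt_le_trans (_ : (Num.bound (a1 + a2 + (1 + eps)))%:R <= _); last by rewrite ler_nat.
  by apply: archi_boundP; lra.
have k_gt0 : (0 : R) < k%:R by lra.
have a1k : L%:R * (4 + 2 * eps) <= k%:R * eps by rewrite -ler_pdivrMr // -/a1; lra.
have a2k : 2 + eps <= k%:R * d ^+ 2 by rewrite -ler_pdivrMr // -/a2; lra.
have Lk : (L <= k)%N.
  rewrite -(ler_nat R) -(ler_pM2r heps); apply: le_trans a1k.
  by apply: ler_wpM2l => //; lra.
pose p1 := (1 + eps / 2) / k%:R.
have p1k : p1 * k%:R = 1 + eps / 2 by rewrite /p1 divfK // gt_eqF.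
have p1_ge0 : 0 <= p1 by rewrite divr_ge0 //; lra.
have p1_lt1 : p1 < 1 by rewrite ltr_pdivrMr //; lra.
have pp1 : eps / 2 / k%:R <= p - p1.
  by rewrite lerBrDr -mulrDl; apply: le_trans hp; apply: ler_wpM2r; [rewrite invr_ge0 ltW|lra].
have gap_gt0 : 0 < eps / 2 / k%:R by rewrite !divr_gt0.
(* The solution of [1 - p = (1 - p1) * (1 - p2)]. *)
pose p2 := (p - p1) / (1 - p1).
have p2_ge : eps / 2 / k%:R <= p2.
  apply: (le_trans pp1); rewrite ler_pdivlMr ?subr_gt0 //.
  by apply: ler_piMr; lra.
have p2_le1 : p2 <= 1 by rewrite ler_pdivrMr ?subr_gt0 //; lra.
have pE : p = p1 + p2 - p1 * p2.
  by rewrite /p2; field; rewrite gt_eqF // subr_gt0.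
have p1_01 : 0 <= p1 <= 1 by rewrite p1_ge0 ltW.
have p2_01 : 0 <= p2 <= 1 by rewrite p2_le1 andbT; lra.
have q01 : 0 <= q <= 1 by rewrite !ltW.
have mp : 1 + eps / 4 <= (k - L)%:R * p1.
  rewrite /p1 mulrA ler_pdivlMr // natrB //; lra.
have sm := offspring_gf_le heps p1_01 mp.
have deg' v : (k - L + L <= degree G v)%N by rewrite subnK.
have := sprinkle_bound L p1_01 p2_01 q01 sm deg'.
rewrite -pE; move: (Gp_expect _ _ _) => X.
have := card_edges_ge deg; rewrite -(ler_nat R) !natrM.
move: #|edges G|%:R (ler0n R #|edges G|) #|V|%:R (ler0n R #|V|) => e e_ge0 n n_ge0 hE hX.
have L0 : (0 : R) < L%:R.
  by rewrite -(pmulr_lgt0 _ (mulr_gt0 heps dd0)); apply: lt_trans LE.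
have p1d : d ^+ 2 / 2 <= d ^+ 2 - p1.
  by rewrite -(ler_pM2r k_gt0) mulrBl p1k; lra.
have edge_bound : eps * d ^+ 2 / 8 * n <= p2 * ((d ^+ 2 - p1) * e).
  (* The factor [k] in the edge count cancels the [1 / k] in the lower bound for [p2], so the gain
     is linear in [n] uniformly in [k]. *)
  apply: (@le_trans _ _ (eps / 2 / k%:R * (d ^+ 2 / 2 * (n * k%:R / 2)))).
    by rewrite le_eqVlt; apply/orP; left; apply/eqP; field; rewrite gt_eqF.
  apply: ler_pM => //; [exact: ltW | by rewrite !mulr_ge0 ?invr_ge0 // ltW|].
  apply: ler_pM => //; [by rewrite divr_ge0 // ltW | by rewrite !mulr_ge0 ?invr_ge0 // ltW|].
  by lra.
have LX : L%:R * (eps * d ^+ 2 / 8 * n) - n <= L%:R * X.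
  by apply: le_trans hX; rewrite lerD2r; apply: ler_wpM2l => //; apply: edge_bound.
rewrite -(ler_pM2l L0); apply: le_trans LX.
have := ler_wpM2r n_ge0 (ltW LE); lra.
Qed.
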